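(* Let $G$ be a finite simple graph with vertex set $V_G$, $n=\#V_G$, and nonempty edge set $E_G$. Let $j\geq 0$ be the integer such that $$\sum_{s=0}^{j-1}(n-s) < \#E_G \leq \sum_{s=0}^{j}(n-s),$$ and let $l=\#E_G-\sum_{s=0}^{j-1}(n-s)$ (where $\sum_{s=0}^{j-1}(n-s)=0$ if $j=0$). Then $$\max\left\{0,\ \sum_{v \in V_G} \binom{\deg v}{2} - j\binom{\#V_G}{2} + \binom{j}{j-3} - \bigl(j+(j+1)+\cdots + (j+l-1)\bigr)\right\} \leq k_3(G).$$
   Context: A simple graph has no loops or multiple edges; it need not be connected. The degree $\deg v$ of a vertex $v$ is the number of edges incident to $v$. $k_3(G)$ is the number of triangles in $G$, i.e. the number of induced subgraphs of $G$ isomorphic to the complete graph $K_3$. The binomial coefficient $\binom{j}{j-3}$ is $0$ when $j<3$. The sum $j+(j+1)+\cdots+(j+l-1)$ has $l$ terms. *)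

(* Defs.v *)
From mathcomp Require Import all_boot all_order all_algebra.

Set Implicit Arguments.
Unset Strict Implicit.
Unset Printing Implicit Defensive.

Record sgraph := SGraph {
  svertex :> finType;
  sadj : rel svertex;
  sadj_sym : symmetric sadj;
  sadj_irrefl : irreflexive sadj
}.

Definition edges (G : sgraph) : {set {set G}} :=
  [set [set p.1; p.2] | p : G * G & sadj p.1 p.2].

Definition deg (G : sgraph) (v : G) : nat := #|[set A in edges G | v \in A]|.

Lemma complete_adj_sym n : symmetric (fun x y : 'I_n => x != y).
Proof. by move=> x y; rewrite eq_sym. Qed.

Lemma complete_adj_irrefl n : irreflexive (fun x y : 'I_n => x != y).
Proof. by move=> x; rewrite eqxx. Qed.

Definition complete (n : nat) : sgraph :=
  SGraph (@complete_adj_sym n) (@complete_adj_irrefl n).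

Section Induced.
Variables (G : sgraph) (S : {set G}).

Definition induced_adj : rel {x : G | x \in S} :=
  fun x y => sadj (val x) (val y).

Lemma induced_adj_sym : symmetric induced_adj.
Proof. by move=> x y; apply: sadj_sym. Qed.

Lemma induced_adj_irrefl : irreflexive induced_adj.
Proof. by move=> x; apply: sadj_irrefl. Qed.

Definition induced : sgraph := SGraph induced_adj_sym induced_adj_irrefl.
End Induced.

Definition sgraph_iso (G H : sgraph) : bool :=
  [exists f : {ffun G -> H},
    [&& injectiveb f,
        [forall y : H, exists x : G, f x == y] &
        [forall x : G, forall y : G, sadj (f x) (f y) == sadj x y]]].

(* Induced subgraphs correspond one-to-one to vertex sets. *)
Definition k3 (G : sgraph) : nat :=
  #|[set S : {set G} | sgraph_iso (induced S) (complete 3)]|.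

(* The binomial coefficient (j choose j - 3); the test is needed because j - 3
   is truncated, so that 'C(j, j - 3) = 1 when j < 3. *)
Definition bin_sub3 (j : nat) : nat := if (j < 3)%N then 0 else 'C(j, j - 3).

(* Main.v *)
Require Import Defs.
From mathcomp Require Import all_boot all_order all_algebra.
From mathcomp Require Import zify.
Import Order.TTheory GRing.Theory Num.Theory.

(** A triple of vertices spanning [e] edges contributes [max (0, e - 1)] to
    the sum of the ['C(deg v, 2)] minus the number of triangles.  Since the
    total of all [e] is fixed by the number of edges, an upper bound on this
    difference is the same as an upper bound on the number of triples without
    edges, that is, on the triangles of the complement of [G].

    That bound is a form of Macaulay's growth theorem from degree 2 to degree
    3.  Call two vertices compatible when they are equal or not adjacent, and
    count multisets of pairwise compatible vertices: [h2] of size 2 and [h3]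
    of size 3.  If [h2 = 'C(A, 2) + B] with [B <= A], then
    [h3 <= 'C(A + 1, 3) + 'C(B + 1, 2)] ([clique_bound]).  This goes by
    induction on the number of vertices, for the representation of [h2] with
    [B < A].  Delete a vertex compatible with the least number [e] of vertices
    (itself included): [h2] drops by exactly [e] and [h3] by at most
    ['C(e + 1, 2)].  By minimality, ['C(e + 1, 2) <= h2 < 'C(A + 1, 2)], so
    that [e < A]; and then the bound, as a function of [h2], loses at least
    ['C(e + 1, 2)] when [h2] drops by [e] ([macaulay_drop]), by convexity of
    ['C(_, 2)].

    With [m] edges written as [n + (n - 1) + ... + (n - j + 1) + l], the
    complement has [h2 = 'C(n - j, 2) + (n - j - l)], so the theorem is
    [clique_bound] at [A = n - j] and [B = n - j - l], translated back to [G]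
    by counting ordered tuples ([pairs_nonadj], [triples_nonadj] and
    [ordered_triangles]). *)

(** * The growth function *)

Section Arithmetic.
Local Open Scope nat_scope.

Lemma bin2_sqr n : 2 * 'C(n, 2) + n = n * n.
Proof. by elim: n => // n IH; rewrite binS bin1; nia. Qed.

Lemma bin3_cube n : 6 * 'C(n, 3) + 3 * (n * n) = n * n * n + 2 * n.
Proof. by elim: n => // n IH; rewrite binS; have := bin2_sqr n; nia. Qed.

Lemma bin2_convex a b c d :
  a + b = c + d -> a <= d -> b <= d -> 'C(a, 2) + 'C(b, 2) <= 'C(c, 2) + 'C(d, 2).
Proof.
move=> abcd le_ad le_bd.
have [k def_d] : exists k, d = a + k by exists (d - a); lia.
have [i def_b] : exists i, b = c + k /\ d = c + k + i by exists (d - b); lia.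
have := (bin2_sqr a, bin2_sqr b, bin2_sqr c, bin2_sqr d).
move=> [[[]]]; nia.
Qed.

(** In terms of [h = 'C(A, 2) + B], the bound ['C(A + 1, 3) + 'C(B + 1, 2)] is
    the sum of the first [h] terms of 1, 1, 2, 1, 2, 3, and so on, the last
    block being 1, ..., B.  Its last [e] terms dominate 1, ..., e when [e < A]:
    they are either inside the last block, or consist of that block and the
    top of the block 1, ..., A - 1. *)
Lemma macaulay_drop A B e : B < A -> e < A ->
  exists A' B', [/\ B' <= A', 'C(A, 2) + B = 'C(A', 2) + B' + e
    & 'C(A'.+1, 3) + 'C(B'.+1, 2) + 'C(e.+1, 2) <= 'C(A.+1, 3) + 'C(B.+1, 2)].
Proof.
move=> ltBA lteA; have [leeB | ltBe] := leqP e B.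
  exists A, (B - e); split; [lia | lia |].
  rewrite -addnA leq_add2l; apply: (bin2_convex _ _ 1 B.+1); lia.
case: A => // A in ltBA lteA *.
exists A, (B + A - e); split; [lia | rewrite binS bin1; lia |].
have : 'C((B + A - e).+1, 2) + 'C(e.+1, 2) <= 'C(B.+1, 2) + 'C(A.+1, 2).
  apply: bin2_convex; lia.
by rewrite (binS A.+1 2); lia.
Qed.
End Arithmetic.

(** * Cliques of a reflexive symmetric relation *)

Section Clique.
Local Open Scope nat_scope.
Variables (T : finType) (c : rel T).
Hypotheses (c_sym : symmetric c) (c_refl : reflexive c).
Implicit Type S : {set T}.

Definition pairs S := \sum_(x in S) \sum_(y in S) c x y.
Definition triples S :=
  \sum_(x in S) \sum_(y in S) \sum_(z in S) c x y * c y z * c x z.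

Lemma pairsD1 S v : v \in S ->
  pairs S = pairs (S :\ v) + 2 * (\sum_(y in S :\ v) c v y) + 1.
Proof.
move=> vS; rewrite /pairs (big_setD1 v vS) /= (big_setD1 v vS) /= c_refl.
under [X in _ + X = _]eq_bigr => x _ do rewrite (big_setD1 v vS) /= c_sym.
by rewrite big_split /=; lia.
Qed.

(** Related triples are sorted by the set of positions that [v] occupies: by
    symmetry the three single positions contribute equally, and so do the three
    pairs of positions, where the third entry is a neighbour of [v]. *)
Lemma triplesD1 S v : v \in S ->
  triples S = triples (S :\ v)
    + 3 * (\sum_(y in S :\ v) \sum_(z in S :\ v) c v y * c y z * c v z)
    + 3 * (\sum_(y in S :\ v) c v y) + 1.
Proof.
move=> vS; have split1 F : \sum_(x in S) F x = F v + \sum_(x in S :\ v) F x.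
  exact: big_setD1.
pose u := \sum_(y in S :\ v) c v y.
pose w := \sum_(y in S :\ v) \sum_(z in S :\ v) c v y * c y z * c v z.
have at_v : \sum_(y in S) \sum_(z in S) c v y * c y z * c v z = 1 + 2 * u + w.
  rewrite !split1 c_refl /=.
  under eq_bigr => z _ do rewrite mul1n mulnb andbb.
  under [X in _ + _ + X]eq_bigr => y _ do
    rewrite split1 c_refl muln1 (c_sym y v) mulnb andbb.
  by rewrite big_split /= -/u -/w; lia.
have off_v x : \sum_(y in S) \sum_(z in S) c x y * c y z * c x z =
    c v x + ((\sum_(y in S :\ v) c v x * c x y * c v y)
    + \sum_(y in S :\ v) c v x * c x y * c v y)
    + \sum_(y in S :\ v) \sum_(z in S :\ v) c x y * c y z * c x z.
  rewrite !split1 c_refl muln1 (c_sym x v) mulnb andbb.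
  under [X in _ + _ + X]eq_bigr => y _ do rewrite split1.
  rewrite big_split /= addnA; congr (_ + _); rewrite -addnA; congr (_ + _).
  congr (_ + _); apply: eq_bigr => y _.
    by rewrite -mulnA (mulnC (c v y)) mulnA.
  by rewrite (c_sym x v) (c_sym y v) mulnC mulnA; nia.
rewrite /triples split1 at_v.
under eq_bigr => x _ do rewrite off_v.
by rewrite !big_split /= -/u -/w; lia.
Qed.

(** By Burnside's lemma for permutations of the positions, [pairs S + #|S|] is
    twice the number of 2-multisets of pairwise related elements of [S], and
    [triples S + 3 * pairs S + 2 * #|S|] is six times the number of such
    3-multisets; this keeps all the counts ordered. *)
Lemma clique_bound S A B : B <= A ->
  pairs S + #|S| = 2 * ('C(A, 2) + B) ->
  triples S + 3 * pairs S + 2 * #|S| <= 6 * ('C(A.+1, 3) + 'C(B.+1, 2)).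
Proof.
have [k leSk] := ubnP #|S|; elim: k S A B leSk => // k IH S A B leSk.
(* At B = A, the pairs (A, A) and (A + 1, 0) give the same h and bound. *)
wlog ltBA : A B / B < A => [gen | _].
  rewrite leq_eqVlt => /predU1P[-> | ltBA] hS; last exact: gen (ltnW ltBA) hS.
  have := gen A.+1 0 isT isT; rewrite (binS A.+1 2) (binS A 1) bin1.
  by rewrite (bin_small (n := 1)) //; lia.
move=> hS; have [S0 | [v0 v0S]] := set_0Vmem S.
  by rewrite S0 /triples /pairs !big_set0 cards0.
pose e v := \sum_(y in S) c v y.
have [v /= vS min_v] := arg_minnP e v0S.
have e_v : e v = (\sum_(y in S :\ v) c v y).+1 by rewrite /e (big_setD1 v vS) /= c_refl.
have le_eS : e v <= #|S|.
  by rewrite -sum1_card leq_sum // => y _; case: (c v y).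
have le_pairs : #|S| * e v <= pairs S by rewrite -sum_nat_const leq_sum.
have le_link : \sum_(y in S :\ v) \sum_(z in S :\ v) c v y * c y z * c v z <=
    (\sum_(y in S :\ v) c v y) * (\sum_(z in S :\ v) c v z).
  rewrite big_distrlr /= leq_sum // => y _; rewrite leq_sum // => z _.
  by case: (c v y) (c y z) (c v z) => [] [] [].
(* Otherwise pairs S + #|S| >= e (e + 1) >= A (A + 1) > 2 ('C(A, 2) + B). *)
have lteA : e v < A by have := bin2_sqr A; nia.
have SD1 := cardsD1 v S; rewrite (vS : v \in S) in SD1.
have [A' [B' [leBA' eqAB leAB]]] := macaulay_drop A B (e v) ltBA lteA.
have ltk : #|S :\ v| < k by lia.
have pS := pairsD1 S v vS; have tS := triplesD1 S v vS.
have := IH (S :\ v) A' B' ltk leBA' ltac:(lia).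
by have := bin2_sqr (e v).+1; nia.
Qed.
End Clique.
Arguments pairs {T}.
Arguments triples {T}.

(** * Counting in a graph *)

Lemma sum_setT (T : finType) (F : T -> nat) :
  (\sum_(x in [set: T]) F x = \sum_x F x)%N.
Proof. by apply: eq_bigl => x; rewrite inE. Qed.

Section Graph.
Local Open Scope nat_scope.
Variable G : sgraph.
Local Notation adj := (@sadj G).

Lemma deg_sum_adj (v : G) : deg v = \sum_(y : G) adj v y.
Proof.
have -> : \sum_(y : G) adj v y = #|adj v|.
  rewrite -sum1_card [RHS]big_mkcond; apply: eq_bigr => y _.
  by rewrite -[y \in _]/(adj v y); case: (adj v y).
rewrite /deg.
have -> : [set A in edges G | v \in A] = [set [set v; y] | y in adj v].
  apply/setP=> A; rewrite inE; apply/andP/imsetP.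
    case=> /imsetP[[x y]]; rewrite inE /= => xy ->.
    rewrite !inE => /orP[] /eqP->; first by exists y.
    by rewrite sadj_sym in xy; exists x; rewrite // setUC.
  case=> y vy ->; rewrite !inE eqxx; split=> //.
  by apply/imsetP; exists (v, y); rewrite ?inE.
apply: card_in_imset.
move=> y z vy vz /setP eq_yz; have := eq_yz y; rewrite !inE eqxx orbT.
case/esym/orP=> /eqP // def_y.
by move: vy; rewrite def_y -[_ \in _]/(adj v v) sadj_irrefl.
Qed.

Lemma handshake : 2 * #|edges G| = \sum_(x : G) \sum_(y : G) adj x y.
Proof.
transitivity (\sum_(A in edges G) \sum_(v : G) (v \in A : nat)).
  rewrite mulnC -sum_nat_const; apply: eq_bigr => A.
  move=> /imsetP[[x y]]; rewrite inE /= => xy ->; rewrite -big_mkcond sum1_card cards2.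
  by case: eqVneq xy => // ->; rewrite sadj_irrefl.
rewrite exchange_big; apply: eq_bigr => v _; rewrite -deg_sum_adj /deg.
rewrite -sum1_card big_mkcond [RHS]big_mkcond; apply: eq_bigr => A _.
by rewrite inE; case: (A \in _) (v \in A) => [] [].
Qed.

(** Any bijection between two cliques is an isomorphism, so the enumeration of
    [S] will do. *)
Lemma clique3_iso (S : {set G}) : #|S| = 3 ->
  {in S &, forall x y, x != y -> adj x y} ->
  sgraph_iso (induced S) (complete 3).
Proof.
move=> S3 S_clique.
have eq3 : #|{: {x : G | x \in S}}| = 3 by rewrite card_sig.
pose f := [ffun u : induced S => cast_ord eq3 (enum_rank u) : complete 3].
have f_inj : injective f.
  by move=> u w; rewrite !ffunE => /cast_ord_inj/enum_rank_inj.
apply/existsP; exists f; apply/and3P; split; first exact/injectiveP.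
  apply/forallP=> i; apply/existsP; exists (enum_val (cast_ord (esym eq3) i)).
  by rewrite ffunE enum_valK cast_ordKV.
apply/forallP=> u; apply/forallP=> w; apply/eqP.
rewrite /= /induced_adj (inj_eq f_inj); have [->|neq_uw] := eqVneq u w.
  by rewrite sadj_irrefl.
by rewrite S_clique ?(valP u) ?(valP w) // (inj_eq val_inj).
Qed.

(** Each ordered triangle is one of the [3 * 2 * 1] orderings of a vertex set
    counted by [k3]. *)
Lemma ordered_triangles :
  \sum_(x : G) \sum_(y : G) \sum_(z : G) adj x y * adj y z * adj x z <= 6 * k3 G.
Proof.
set K := [set S : {set G} | sgraph_iso (induced S) (complete 3)].
have card_K S : S \in K -> #|S| = 3.
  rewrite inE => /existsP[f /and3P[/injectiveP f_inj /forallP f_surj _]].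
  have : #|induced S| = #|complete 3|.
    apply/eqP; rewrite eqn_leq (leq_card f f_inj) /=.
    rewrite -(card_codom f_inj); apply/subset_leq_card/subsetP => y _.
    by have /existsP[x /eqP <-] := f_surj y; apply: codom_f.
  by rewrite card_ord card_sig.
(* flag S x y z says that (x, y, z) enumerates three distinct elements of S. *)
pose flag (S : {set G}) x y z : nat :=
  (x \in S) * (y \in S :\ x) * (z \in S :\ x :\ y).
have sum_mem (A : {set G}) : \sum_z (z \in A : nat) = #|A|.
  by rewrite -sum1_card [RHS]big_mkcond; apply: eq_bigr => z _; case: (z \in A).
have card_flags S : S \in K -> \sum_x \sum_y \sum_z flag S x y z = 6.
  move=> /card_K S3.
  have -> : 6 = \sum_x (x \in S : nat) * 2 by rewrite -big_distrl sum_mem S3.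
  apply: eq_bigr => x _; case xS: (x \in S); last first.
    by rewrite big1 // => y _; rewrite big1 // => z _; rewrite /flag xS.
  have Sx2 : #|S :\ x| = 2 by move: (cardsD1 x S); rewrite xS S3; lia.
  rewrite mul1n -Sx2 -sum_mem; apply: eq_bigr => y _.
  rewrite /flag -big_distrr sum_mem xS mul1n /=.
  case yS: (y \in S :\ x); rewrite ?mul0n // mul1n.
  by move: (cardsD1 y (S :\ x)); rewrite yS Sx2; lia.
have -> : 6 * k3 G = \sum_(S in K) \sum_x \sum_y \sum_z flag S x y z.
  by rewrite (eq_bigr (fun=> 6)) // sum_nat_const mulnC.
rewrite [X in _ <= X]exchange_big leq_sum // => x _.
rewrite [X in _ <= X]exchange_big leq_sum // => y _.
rewrite [X in _ <= X]exchange_big leq_sum // => z _.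
case xy: (adj x y); case yz: (adj y z); case xz: (adj x z) => //.
have neq a b : adj a b -> a != b by apply: contraTneq => ->; rewrite sadj_irrefl.
have [[nxy nyz] nxz] := (neq _ _ xy, neq _ _ yz, neq _ _ xz).
have SK : [set x; y; z] \in K.
  rewrite inE; apply: clique3_iso.
    by rewrite -setUA cardsU1 cards2 !inE negb_or nxy nxz nyz.
  move=> a b; rewrite !inE -!orbA.
  by move=> /or3P[] /eqP-> /or3P[] /eqP->; rewrite ?eqxx // => _; rewrite // sadj_sym.
rewrite (bigD1 _ SK) /= (leq_trans _ (leq_addr _ _)) //.
by rewrite /flag !inE !eqxx !orbT /= eq_sym nxy eq_sym nyz eq_sym nxz.
Qed.

Lemma pairs_nonadj :
  pairs (fun x y : G => ~~ adj x y) setT + 2 * #|edges G| = #|G| ^ 2.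
Proof.
rewrite handshake /pairs sum_setT -big_split /=.
rewrite -mulnn -sum_nat_const; apply: eq_bigr => x _.
rewrite sum_setT -big_split /= -sum1_card.
by apply: eq_bigr => y _; case: (adj x y).
Qed.

(** Expand the product of the three factors [1 - adj]: the linear terms count
    edges with a free third vertex, the quadratic ones count pairs of edges
    meeting at one of the three positions. *)
Lemma triples_nonadj :
  triples (fun x y : G => ~~ adj x y) setT + 6 * #|G| * #|edges G|
    + \sum_(x : G) \sum_(y : G) \sum_(z : G) adj x y * adj y z * adj x z
  = #|G| ^ 3 + 3 * \sum_(v : G) deg v ^ 2.
Proof.
have deg_sqr (v : G) : \sum_(x : G) \sum_(z : G) adj v x * adj v z = deg v ^ 2.
  by rewrite -mulnn deg_sum_adj big_distrlr.
have pt x y z : ~~ adj x y * ~~ adj y z * ~~ adj x z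
      + (adj x y + adj y z + adj x z) + adj x y * adj y z * adj x z
    = 1 + (adj x y * adj x z + adj y x * adj y z + adj z x * adj z y).
  rewrite (sadj_sym y x) (sadj_sym z x) (sadj_sym z y).
  by case: (adj x y) (adj y z) (adj x z) => [] [] [].
have sum3D (E F : G -> G -> G -> nat) :
    \sum_x \sum_y \sum_z (E x y z + F x y z)
    = \sum_x \sum_y \sum_z E x y z + \sum_x \sum_y \sum_z F x y z.
  rewrite -big_split; apply: eq_bigr => x _; rewrite -big_split.
  by apply: eq_bigr => y _; rewrite -big_split.
have sum_edge : \sum_(x : G) \sum_(y : G) \sum_(z : G) adj x y = 2 * #|G| * #|edges G|.
  under eq_bigr => x _ do under eq_bigr => y _ do rewrite sum_nat_const.
  under eq_bigr => x _ do rewrite -big_distrr.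
  by rewrite -big_distrr -handshake /= mulnCA mulnA.
have sum_edge' : \sum_(x : G) \sum_(y : G) \sum_(z : G) adj y z = 2 * #|G| * #|edges G|.
  by rewrite sum_nat_const -handshake mulnCA mulnA.
have sum_edge'' : \sum_(x : G) \sum_(y : G) \sum_(z : G) adj x z = 2 * #|G| * #|edges G|.
  by rewrite -sum_edge; apply: eq_bigr => x _; rewrite exchange_big.
have sum_cherry : \sum_(x : G) \sum_(y : G) \sum_(z : G) adj x y * adj x z
    = \sum_(v : G) deg v ^ 2.
  exact: eq_bigr.
have sum_cherry' : \sum_(x : G) \sum_(y : G) \sum_(z : G) adj y x * adj y z
    = \sum_(v : G) deg v ^ 2.
  by rewrite exchange_big; apply: eq_bigr.
have sum_cherry'' : \sum_(x : G) \sum_(y : G) \sum_(z : G) adj z x * adj z y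
    = \sum_(v : G) deg v ^ 2.
  under eq_bigr => x _ do rewrite exchange_big.
  by rewrite exchange_big; apply: eq_bigr.
have : \sum_(x : G) \sum_(y : G) \sum_(z : G)
      (~~ adj x y * ~~ adj y z * ~~ adj x z
      + (adj x y + adj y z + adj x z) + adj x y * adj y z * adj x z)
    = \sum_(x : G) \sum_(y : G) \sum_(z : G)
      (1 + (adj x y * adj x z + adj y x * adj y z + adj z x * adj z y)).
  by apply: eq_bigr => x _; apply: eq_bigr => y _; apply: eq_bigr => z _.
have sum_1 : \sum_(x : G) \sum_(y : G) \sum_(z : G) 1 = #|G| ^ 3.
  by rewrite !sum_nat_const muln1.
rewrite !sum3D sum_edge sum_edge' sum_edge'' sum_cherry sum_cherry' sum_cherry'' sum_1.
have -> : triples (fun x y : G => ~~ adj x y) setT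
    = \sum_(x : G) \sum_(y : G) \sum_(z : G) ~~ adj x y * ~~ adj y z * ~~ adj x z.
  rewrite /triples sum_setT; apply: eq_bigr => x _.
  by rewrite sum_setT; apply: eq_bigr => y _; rewrite sum_setT.
by lia.
Qed.

End Graph.

(** * The lower bound on triangles *)

Local Open Scope ring_scope.

Theorem corollary3p5 (G : sgraph) (n j l : nat)
  (hn : n = #|G|)
  (hE : edges G != set0)
  (hj : \sum_(0 <= s < j) (n%:Z - s%:Z) < #|edges G|%:Z
          <= \sum_(0 <= s < j.+1) (n%:Z - s%:Z))
  (hl : l%:Z = #|edges G|%:Z - \sum_(0 <= s < j) (n%:Z - s%:Z)) :
  Num.max 0
    (\sum_(v : G) 'C(deg v, 2)%:Z - j%:Z * 'C(#|G|, 2)%:Z + (bin_sub3 j)%:Z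
       - \sum_(0 <= i < l) (j%:Z + i%:Z))
    <= (k3 G)%:Z.
Proof.
rewrite ge_max lez_nat leq0n /=.
have sum_rows k : \sum_(0 <= s < k) (n%:Z - s%:Z) = k%:Z * n%:Z - 'C(k, 2)%:Z.
  elim: k => [|k IH]; first by rewrite big_nil mul0r.
  rewrite big_nat_recr //= IH binS bin1; lia.
have sum_last : \sum_(0 <= i < l) (j%:Z + i%:Z) = l%:Z * j%:Z + 'C(l, 2)%:Z.
  elim: (l) => [|k IH]; first by rewrite big_nil mul0r.
  rewrite big_nat_recr //= IH binS bin1; lia.
have bin_j : bin_sub3 j = 'C(j, 3).
  by rewrite /bin_sub3; case: ltnP => [/bin_small|/bin_sub] ->.
rewrite sum_last bin_j -hn; rewrite !sum_rows in hj hl.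
have bin2_deg : 2 * \sum_(v : G) 'C(deg v, 2)%:Z + 2 * #|edges G|%:Z
    = (\sum_(v : G) deg v ^ 2)%N%:Z.
  have : (2 * (\sum_(v : G) 'C(deg v, 2)) + 2 * #|edges G|
      = \sum_(v : G) deg v ^ 2)%N.
    rewrite handshake big_distrr -big_split /=; apply: eq_bigr => v _.
    by rewrite -deg_sum_adj bin2_sqr -mulnn.
  by rewrite -(big_morph Posz PoszD (erefl (Posz 0))); lia.
have [lt_jn le_l] : (j < n)%N /\ (l <= n - j)%N.
  have := hj; rewrite binS bin1; have := bin2_sqr j; split; nia.
set c := fun x y : G => ~~ sadj x y.
have c_sym : symmetric c by move=> x y; rewrite /c sadj_sym.
have c_refl : reflexive c by move=> x; rewrite /c sadj_irrefl.
have pairs_c : (pairs c setT + 2 * #|edges G| = n ^ 2)%N by rewrite hn pairs_nonadj.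
have triples_c := triples_nonadj G; rewrite -/c -hn in triples_c.
have le_k3 := ordered_triangles G.
have := clique_bound _ c c_sym c_refl setT (n - j) (n - j - l) (leq_subr _ _).
rewrite cardsT -hn.
have := (bin2_sqr n, bin2_sqr j, bin2_sqr l, bin3_cube j).
have := (bin2_sqr (n - j), bin2_sqr (n - j - l), bin2_sqr (n - j - l).+1, bin3_cube (n - j).+1).
(* Writing n = j + l + a removes the truncated subtractions. *)
have [a def_n] : exists a, n = (j + l + a)%N by exists (n - j - l)%N; lia.
have [-> ->] : (n - j = l + a /\ n - j - l = a)%N by lia.
move=> [[[bin_A bin_a] bin_a1] bin_A1] [[[bin_n bin_jj] bin_l] bin_j3].
move: (pairs c _) (triples c _) pairs_c triples_c => P2 T3 pairs_c triples_c.
move: (\sum_x \sum_y _)%N triples_c le_k3 => tau triples_c le_k3.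
move: (\sum_v _)%N bin2_deg triples_c => D bin2_deg triples_c.
move: (\sum_v _) bin2_deg => B2 bin2_deg.
move: #|edges G| hj hl bin2_deg pairs_c triples_c => m hj hl bin2_deg pairs_c triples_c.
(* With these products of hl and of the binomial identities, what remains is
   linear in the monomials of the expanded goal. *)
have jbin_n : j%:Z * (2 * 'C(n, 2)%:Z) = j%:Z * (n%:Z * n%:Z - n%:Z) by congr (_ * _); lia.
have nbin_j : n%:Z * (2 * 'C(j, 2)%:Z) = n%:Z * (j%:Z * j%:Z - j%:Z) by congr (_ * _); lia.
have nm : n%:Z * m%:Z = n%:Z * (l%:Z + (j%:Z * n%:Z - 'C(j, 2)%:Z)) by congr (_ * _); lia.
clear hj lt_jn le_l hn hE sum_rows sum_last bin_j.
rewrite !def_n in bin_n hl pairs_c triples_c jbin_n nbin_j nm *.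
move=> bound; have {}bound := bound ltac:(lia).
lia.
Qed.
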